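(* Let $m,n,k$ be integers with $n,m\geq k\geq 0$. There is a bijection between $\mathrm{PF}^2(m,n)^{\ast k}$ and the set of $(k,n,m)$-shuffle paths which preserves both statistics $\mathrm{dinv}$ and $\mathrm{area}$.
   Context: A Dyck path of size $N$ is a lattice path from $(0,0)$ to $(N,N)$ with unit North and East steps staying weakly above the line $y=x$. A labelled Dyck path is a Dyck path whose vertical steps carry positive integer labels, strictly increasing from bottom to top within each column; $l_i(D)$ is the label of the $i$-th vertical step (from the bottom). The area word is $a_1(D)\cdots a_N(D)$, where $a_i(D)$ is the number of whole squares in the $i$-th row between the path and the diagonal. The rises are the indices $2\le i\le N$ with $a_i(D)>a_{i-1}(D)$. A decorated Dyck path is one in which some rises are marked with $\ast$; let $\mathrm{DRise}(D)$ be the set of decorated rises. Then $\mathrm{area}(D)=\sum_{i\notin \mathrm{DRise}(D)}a_i(D)$. For $1\le i<j\le N$, $(i,j)$ is a diagonal inversion if either $a_i(D)=a_j(D)$ and $l_i(D)<l_j(D)$, or $a_i(D)=a_j(D)+1$ and $l_i(D)>l_j(D)$; $\mathrm{dinv}(D)$ is the number of diagonal inversions (decorations are ignored). The dinv reading word of $D$ lists the labels by reading the cells on the diagonal $y=x$ bottom to top, then those on $y=x+1$ bottom to top, then $y=x+2$, etc. $\mathrm{PF}^2(m,n)^{\ast k}$ is the set of decorated labelled Dyck paths of size $m+n$ with exactly $k$ decorated rises, whose labels are all in $\{1,2\}$, with exactly $n$ labels equal to $1$ and $m$ labels equal to $2$. A $(k,n,m)$-shuffle path is an undecorated labelled Dyck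 path of size $m+n-k$ whose labels are exactly $1,2,\dots,m+n-k$ (each once) and whose dinv reading word is a shuffle of the three sequences $(1,2,\dots,k)$, $(n,n-1,\dots,k+1)$ and $(m+n-k,\dots,n+1)$ (i.e. each of these appears as a subsequence in the given order). *)

(* Defs.v *)
From mathcomp Require Import all_boot.

Set Implicit Arguments.
Unset Strict Implicit.
Unset Printing Implicit Defensive.

(* A lattice path is a sequence of booleans: [true] is a North step and
   [false] an East step. *)
Definition is_dyck (N : nat) (s : seq bool) : bool :=
  (count id s == N) &&
  all (fun j => count negb (take j s) <= count id (take j s))
      (iota 0 (size s).+1).

Record dyck_path (N : nat) := DyckPath {
  steps : (N + N).-tuple bool;
  _ : is_dyck N steps
}.

(* The abscissas of the vertical steps of [s], from bottom to top. *)
Definition vertical_abscissas (s : seq bool) : seq nat :=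
  [seq count negb (take j s) | j <- iota 0 (size s) & nth false s j].

(* Rows and vertical steps are indexed from 0, so that row [i] is the strip
   i <= y <= i + 1. *)
Definition abscissa (N : nat) (P : dyck_path N) (i : nat) : nat :=
  nth 0 (vertical_abscissas (steps P)) i.

(* The unit square with lower left corner (c, i) is to the right of the path
   when abscissa P i <= c, and entirely above the line y = x when c + 1 <= i. *)
Definition area_word (N : nat) (P : dyck_path N) (i : nat) : nat :=
  #|[set c : 'I_N | (abscissa P i <= c) && (c.+1 <= i)]|.

Definition is_rise (N : nat) (P : dyck_path N) (i : 'I_N) : bool :=
  (0 < i) && (area_word P i.-1 < area_word P i).

Definition is_labelling (N : nat) (P : dyck_path N) (l : N.-tuple nat) : bool :=
  all (fun x => 0 < x) l &&
  [forall i : 'I_N, forall j : 'I_N,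
     (i < j) && (abscissa P i == abscissa P j) ==> (tnth l i < tnth l j)].

Record labelled_dyck_path (N : nat) := LabelledDyckPath {
  underlying_path :> dyck_path N;
  labels : N.-tuple nat;
  _ : is_labelling underlying_path labels
}.

(* The set of decorated rises may be empty: an undecorated labelled Dyck path is
   one with [DRise D = set0]. *)
Record decorated_path (N : nat) := DecoratedPath {
  underlying_labelled :> labelled_dyck_path N;
  DRise : {set 'I_N};
  _ : DRise \subset [set i | is_rise underlying_labelled i]
}.

Definition area (N : nat) (D : decorated_path N) : nat :=
  \sum_(i < N | i \notin DRise D) area_word D i.

Definition diagonal_inversion (N : nat) (D : labelled_dyck_path N)
    (i j : 'I_N) : bool :=
  (i < j) &&
  (((area_word D i == area_word D j) &&
      (tnth (labels D) i < tnth (labels D) j))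
   || ((area_word D i == (area_word D j).+1) &&
      (tnth (labels D) i > tnth (labels D) j))).

Definition dinv (N : nat) (D : labelled_dyck_path N) : nat :=
  #|[set ij : 'I_N * 'I_N | diagonal_inversion D ij.1 ij.2]|.

(* The label of the i-th vertical step lies in the cell of row [i] on the line
   y = x + area_word D i; these diagonals have index at most N - 1. *)
Definition dinv_reading_word (N : nat) (D : labelled_dyck_path N) : seq nat :=
  flatten [seq [seq tnth (labels D) i
                   | i : 'I_N <- enum 'I_N & area_word D i == d]
          | d <- iota 0 N].

Definition is_PF2 (m n k : nat) (D : decorated_path (m + n)) : bool :=
  [&& #|DRise D| == k,
      all (fun x => x \in [:: 1; 2]) (labels D),
      count_mem 1 (labels D) == n
    & count_mem 2 (labels D) == m].

Definition PF2 (m n k : nat) : Type :=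
  {D : decorated_path (m + n) | @is_PF2 m n k D}.

(* The three sequences are (1, ..., k), (n, ..., k + 1) and
   (m + n - k, ..., n + 1), of lengths k, n - k and m - k; the truncated
   subtractions are exact when k <= n and k <= m. As their entries
   partition the labels, a word is a shuffle of them iff each is a
   subsequence of it. *)
Definition is_shuffle_path (k n m : nat) (D : decorated_path (m + n - k)) :
    bool :=
  [&& DRise D == set0,
      perm_eq (labels D) (iota 1 (m + n - k)),
      subseq (iota 1 k) (dinv_reading_word D),
      subseq (rev (iota k.+1 (n - k))) (dinv_reading_word D)
    & subseq (rev (iota n.+1 (m - k))) (dinv_reading_word D)].

Definition shuffle_path (k n m : nat) : Type :=
  {D : decorated_path (m + n - k) | @is_shuffle_path k n m D}.

(* Main.v *)
Require Import Defs.
From mathcomp Require Import all_boot.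
From mathcomp Require Import zify.

Set Implicit Arguments.
Unset Strict Implicit.
Unset Printing Implicit Defensive.

(* With labels in {1, 2}, a rise is a 2 lying directly above a 1. Contract each
   decorated rise of an element of PF2: the rows (a, 1) and (a + 1, 2) become a
   single row of area a and type 0, the other rows keeping their label as type. The
   area is unchanged, and so is dinv once two rows of type 0 are compared as if
   the first one in the reading order had the smaller label. Shuffle paths are
   the standardisations of these typed paths: in the reading order, type 0
   receives 1, ..., k increasingly, types 1 and 2 receive k + 1, ..., n and
   n + 1, ..., m + n - k decreasingly. *)

(** * Dyck paths and their area words *)

(** The accumulator [c] is the current abscissa; it replaces the prefixes of [vertical_abscissas] by
    a structural recursion. *)
Fixpoint abscissas_from (c : nat) (s : seq bool) : seq nat :=
  if s is b :: s' then
    if b then c :: abscissas_from c s' else abscissas_from c.+1 s'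
  else [::].

Lemma vertical_abscissasE s : vertical_abscissas s = abscissas_from 0 s.
Proof.
suff gen c t :
    [seq c + count negb (take j t) | j <- iota 0 (size t) & nth false t j]
      = abscissas_from c t by rewrite -(gen 0 s).
elim: t c => [|b t IH] c //=.
rewrite (iotaDl 1 0) filter_map.
rewrite (eq_filter (a2 := nth false t)) //.
by case: b => /=; rewrite -IH -map_comp ?addn0; [congr (_ :: _)|];
  apply: eq_map => j /=; rewrite ?add0n ?addSnnS.
Qed.

Lemma size_abscissas_from c s : size (abscissas_from c s) = count id s.
Proof. by elim: s c => [|[] s IH] c //=; rewrite IH. Qed.

Lemma path_abscissas_from c s : path leq c (abscissas_from c s).
Proof.
elim: s c => [|[] s IH] c //=; first by rewrite leqnn IH.
by apply: path_le (IH c.+1); [exact: leq_trans | exact: leqnSn].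
Qed.

Fixpoint dyck_from (c h : nat) (s : seq bool) : bool :=
  (c <= h) && (if s is b :: s' then
                 if b then dyck_from c h.+1 s' else dyck_from c.+1 h s'
               else true).

Lemma dyck_fromE s :
  all (fun j => count negb (take j s) <= count id (take j s))
    (iota 0 (size s).+1) = dyck_from 0 0 s.
Proof.
suff gen c h t :
    all (fun j => c + count negb (take j t) <= h + count id (take j t))
      (iota 0 (size t).+1) = dyck_from c h t by rewrite -gen.
elim: t c h => [|b t IH] c h; first by rewrite /= !addn0.
rewrite -[iota _ _]/(0 :: iota (1 + 0) (size t).+1) iotaDl /= !addn0 all_map.
congr (_ && _).
by case: b; rewrite -IH /= !take0 /=; congr (_ && _); try (by lia);
  apply: eq_all => j /=; rewrite ?add0n ?addSnnS.
Qed.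

(** The ballot inequality can fail only along a run of East steps. Such a run ends at a North step,
    where the abscissa is tested, or at the end of the path, where the hypothesis on the totals
    applies. *)
Lemma dyck_from_abscissas c h s : c + count negb s <= h + count id s ->
  reflect (forall i, i < count id s -> nth 0 (abscissas_from c s) i <= h + i)
    (dyck_from c h s).
Proof.
move=> le_s; apply: (iffP idP).
  elim: s c h {le_s} => [|[] s IH] c h //= /andP[le_ch]; last exact: IH.
  by move=> /IH {}IH [|i] lti /=; rewrite ?addn0 // addnS -addSn; apply: IH.
elim: s c h le_s => [|[] s IH] c h /= le_s x_le; first by move: le_s; lia.
  apply/andP; split; first by have := x_le 0 isT; rewrite addn0.
  apply: IH; first by lia.
  by move=> i lti; have := x_le i.+1 lti; rewrite /= addSn addnS.
have dy : dyck_from c.+1 h s by apply: IH; [lia | exact: x_le].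
by rewrite dy andbT; case: {+}s dy => [|b s'] /= /andP[+ _]; lia.
Qed.

(** East runs fill the gaps between consecutive abscissas; the last run leads to abscissa [N]. *)
Fixpoint steps_of_abscissas (N c : nat) (xs : seq nat) : seq bool :=
  if xs is x :: xs' then
    nseq (x - c) false ++ true :: steps_of_abscissas N x xs'
  else nseq (N - c) false.

Lemma abscissas_from_nseq c d s :
  abscissas_from c (nseq d false ++ s) = abscissas_from (c + d) s.
Proof. by elim: d c => [|d IH] c /=; rewrite ?addn0 // IH addSnnS. Qed.

Lemma steps_of_abscissasK N c xs : path leq c xs ->
  abscissas_from c (steps_of_abscissas N c xs) = xs.
Proof.
elim: xs c => [|x xs IH] c /=.
  by rewrite -[nseq _ _]cats0 abscissas_from_nseq.
by case/andP=> le_cx px; rewrite abscissas_from_nseq subnKC //= IH.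
Qed.

Lemma count_steps_of_abscissas N c xs :
    path leq c xs -> c <= N -> all (leq^~ N) xs ->
  count id (steps_of_abscissas N c xs) = size xs /\
  c + count negb (steps_of_abscissas N c xs) = N.
Proof.
elim: xs c => [|x xs IH] c /=.
  by rewrite !count_nseq /=; lia.
case/andP=> le_cx px le_cN /andP[le_xN leN].
by have [e1 e2] := IH x px le_xN leN; rewrite !count_cat /= !count_nseq /=; lia.
Qed.

Lemma abscissas_fromK c s :
  steps_of_abscissas (c + count negb s) c (abscissas_from c s) = s.
Proof.
elim: s c => [|[] s IH] c /=; first by rewrite addn0 subnn.
  by rewrite subnn /= add0n IH.
rewrite add1n addnS -addSn -[in RHS](IH c.+1).
(* An East step lengthens the first run by one; that run stops at the next abscissa or, if no North
   step is left, at the end of the path. *)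
case: (abscissas_from c.+1 s) (path_abscissas_from c.+1 s) => [|x xs] /=.
  by move=> _; rewrite addSn subSn ?leq_addr // subSS.
by case/andP=> lt_cx _; rewrite -(subnSK lt_cx).
Qed.

Section DyckPath.

Variables (N : nat) (P : dyck_path N).

Lemma count_north : count id (steps P) = N.
Proof. by case: P => s /= /andP[/eqP]. Qed.

Lemma count_east : count negb (steps P) = N.
Proof.
have := count_predC id (steps P); rewrite size_tuple count_north.
by rewrite (eq_count (a2 := negb)) // => /addnI.
Qed.

Lemma size_vertical_abscissas : size (vertical_abscissas (steps P)) = N.
Proof. by rewrite vertical_abscissasE size_abscissas_from count_north. Qed.

Lemma abscissa_le i : i < N -> abscissa P i <= i.
Proof.
have : dyck_from 0 0 (steps P) by case: P => s /= /andP[_]; rewrite dyck_fromE.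
move/dyck_from_abscissas; rewrite count_north count_east leqnn => /(_ isT) H.
by move=> /H; rewrite /abscissa vertical_abscissasE.
Qed.

Lemma abscissa_mono i j : i <= j < N -> abscissa P i <= abscissa P j.
Proof.
case/andP=> leij ltj; rewrite /abscissa.
apply: (sorted_leq_nth leq_trans leqnn);
  rewrite ?inE ?size_vertical_abscissas //; last exact: leq_ltn_trans ltj.
by rewrite vertical_abscissasE; apply: path_sorted (path_abscissas_from 0 _).
Qed.

Lemma area_wordE i : i < N -> area_word P i = i - abscissa P i.
Proof.
move=> ltiN; rewrite /area_word; set x := abscissa P i.
(* The truncated difference is the number of [c] with [x <= c < i]. *)
rewrite -[RHS]muln1 -sum_nat_const_nat (big_nat_widen _ _ _ _ _ (ltnW ltiN)).
rewrite (big_nat_widenl x 0) // big_mkord -sum1dep_card.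
by apply: eq_bigl => c; rewrite andTb andbC.
Qed.

Lemma abscissaE i : i < N -> abscissa P i = i - area_word P i.
Proof. by move=> ltiN; rewrite area_wordE // subKn // abscissa_le. Qed.

Lemma area_word_le i : i < N -> area_word P i <= i.
Proof. by move=> ltiN; rewrite area_wordE // leq_subr. Qed.

Lemma area_word_step i : i.+1 < N -> area_word P i.+1 <= (area_word P i).+1.
Proof.
move=> lti; have lti' := ltnW lti; rewrite !area_wordE //.
have := abscissa_mono (i := i) (j := i.+1); rewrite leqnSn lti => /(_ isT).
by have := abscissa_le lti; have := abscissa_le lti'; lia.
Qed.

Lemma abscissa_eqS i : i.+1 < N ->
  (abscissa P i == abscissa P i.+1) = (area_word P i.+1 == (area_word P i).+1).
Proof.
move=> lti; have lti' := ltnW lti; rewrite !area_wordE //.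
have := abscissa_mono (i := i) (j := i.+1); rewrite leqnSn lti => /(_ isT).
by have := abscissa_le lti; have := abscissa_le lti'; lia.
Qed.

Lemma is_riseE (i : 'I_N) : is_rise P i =
  (0 < i) && (area_word P i == (area_word P i.-1).+1).
Proof.
rewrite /is_rise; case: i => [[|i] lti] //=.
by have := area_word_step lti; lia.
Qed.

(** Abscissas increase weakly, so a column occupies consecutive rows; by transitivity only
    neighbouring rows of a column, those where the area word grows by one, need a test. *)
Lemma is_labellingP (l : N.-tuple nat) :
  reflect (all (fun x => 0 < x) l /\
           forall i, i.+1 < N -> area_word P i.+1 = (area_word P i).+1 ->
             nth 0 l i < nth 0 l i.+1)
    (is_labelling P l).
Proof.
apply: (iffP andP) => -[l_gt0 H]; split=> //.
  move=> i lti /eqP; rewrite -abscissa_eqS // => eqx.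
  move/forallP: H => /(_ (Ordinal (ltnW lti)))/forallP/(_ (Ordinal lti)).
  by rewrite /= ltnSn eqx !(tnth_nth 0).
apply/forallP=> i; apply/forallP=> -[j ltj]; apply/implyP=> /= /andP[ltij eqx].
rewrite !(tnth_nth 0) /=; elim: j ltj ltij eqx => // j IH ltj leij /eqP eqx.
have mono1 := abscissa_mono (i := i) (j := j).
have mono2 := abscissa_mono (i := j) (j := j.+1).
have {}eqx : abscissa P i = abscissa P j /\ abscissa P j = abscissa P j.+1 by lia.
case: eqx => eqx1 /eqP; rewrite abscissa_eqS // => /eqP/(H _ ltj) ltS.
move: leij; rewrite ltnS leq_eqVlt => /predU1P[->//|ltij].
by apply: ltn_trans ltS; apply: IH; rewrite ?eqx1 // ltnW.
Qed.

End DyckPath.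

Lemma area_word_inj N (P Q : dyck_path N) :
  (forall i, i < N -> area_word P i = area_word Q i) -> P = Q.
Proof.
move=> eqa.
have eqx : abscissas_from 0 (steps P) = abscissas_from 0 (steps Q).
  rewrite -!vertical_abscissasE; apply: (@eq_from_nth _ 0).
    by rewrite !size_vertical_abscissas.
  move=> i; rewrite size_vertical_abscissas => lti.
  by rewrite -!/(abscissa _ _) !abscissaE ?eqa.
have : steps P = steps Q.
  apply: val_inj; rewrite /= -(abscissas_fromK 0 (steps P)).
  rewrite eqx count_east.
  by have := abscissas_fromK 0 (steps Q); rewrite count_east.
case: P {eqa eqx} => s ds; case: Q => s' ds' /= eqs.
by case: s' / eqs ds' => ds'; congr DyckPath; apply: bool_irrelevance.
Qed.

(** The abscissas must be [i - a i]: growth of [a] by at most one makes them weakly increasing, and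
    [a i <= i] makes the subtraction exact. *)
Lemma dyck_path_of_area_word N (a : nat -> nat) :
    (0 < N -> a 0 = 0) -> (forall i, i.+1 < N -> a i.+1 <= (a i).+1) ->
  {P : dyck_path N | forall i, i < N -> area_word P i = a i}.
Proof.
move=> a0 aS.
have a_le i : i < N -> a i <= i.
  elim: i => [/a0->//|i IH ltiN].
  by apply: leq_trans (aS i ltiN) _; rewrite ltnS IH // ltnW.
pose xs := mkseq (fun i => i - a i) N.
have szx : size xs = N by rewrite size_mkseq.
have px : path leq 0 xs.
  apply/(pathP 0) => i; rewrite szx => lti; rewrite nth_mkseq //.
  case: i lti => [//|i] lti /=; rewrite nth_mkseq ?(ltnW lti) //.
  by have := aS i lti; lia.
have xN : all (leq^~ N) xs.
  by apply/(all_nthP 0) => i; rewrite szx => lti; rewrite nth_mkseq //=; lia.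
have [eN eE] := count_steps_of_abscissas px (leq0n N) xN.
pose s := steps_of_abscissas N 0 xs.
rewrite -/s szx add0n in eN eE.
have szs : size s == N + N.
  rewrite -(count_predC id s) eN (eq_count (a2 := negb)) ?eE //.
have ds : is_dyck N (Tuple szs).
  rewrite /is_dyck dyck_fromE /= eN eqxx /=.
  apply/dyck_from_abscissas; rewrite ?eN ?eE // => i lti.
  by rewrite steps_of_abscissasK // nth_mkseq //; lia.
exists (DyckPath ds) => i lti; rewrite area_wordE // /abscissa /=.
rewrite vertical_abscissasE steps_of_abscissasK // nth_mkseq //.
by rewrite subKn // a_le.
Qed.

(** * Decorated paths as words of rows *)

Fixpoint pair_count (T : Type) (r : rel T) (w : seq T) : nat :=
  if w is x :: w' then count (r x) w' + pair_count r w' else 0.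

Lemma card_pairsE (T : Type) (x0 : T) (r : rel T) N (w : seq T) :
    size w = N ->
  #|[set ij : 'I_N * 'I_N |
      (ij.1 < ij.2) && r (nth x0 w ij.1) (nth x0 w ij.2)]| = pair_count r w.
Proof.
move=> szw; rewrite -sum1dep_card big_mkcond /=.
rewrite -(pair_bigA _ (fun i j : 'I_N =>
  if (i < j) && r (nth x0 w i) (nth x0 w j) then 1 else 0)) /=.
elim: w N szw => [|x w IH] _ <- /=; first by rewrite big_ord0.
(* Row 0 of the double sum collects the pairs starting at the head, as in the recursion of
   [pair_count]. *)
rewrite big_ord_recl big_ord_recl /= add0n; congr (_ + _).
  rewrite -sum1_count (big_nth x0) big_mkord [RHS]big_mkcond /=.
  by apply: eq_bigr.
rewrite -(IH (size w)) //; apply: eq_bigr => i _.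
by rewrite big_ord_recl /= add0n; apply: eq_bigr.
Qed.

Lemma pair_count_cat (T : Type) (r : rel T) (w1 w2 : seq T) :
  pair_count r (w1 ++ w2) =
    pair_count r w1 + pair_count r w2 + \sum_(x <- w1) count (r x) w2.
Proof.
elim: w1 => [|x w1 IH] /=; first by rewrite big_nil addn0.
by rewrite big_cons count_cat IH; lia.
Qed.

(* A row records its area, its label, and whether it is a decorated rise. *)
Definition row : Type := (nat * nat * bool)%type.

Definition rows (N : nat) (D : decorated_path N) : seq row :=
  [seq (area_word D i, tnth (labels D) i, i \in DRise D) | i : 'I_N <- enum 'I_N].

Definition row_step (x y : row) : bool :=
  [&& y.1.1 <= x.1.1.+1, (y.1.1 == x.1.1.+1) ==> (x.1.2 < y.1.2)
    & y.2 ==> (y.1.1 == x.1.1.+1)].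

(** The default value of [head] makes the empty word, that of the path of size 0, valid. *)
Definition valid_rows (w : seq row) : bool :=
  [&& all (fun x : row => 0 < x.1.2) w,
      (head (0, 0, false) w).1.1 == 0, ~~ (head (0, 0, false) w).2
    & sorted row_step w].

Definition row_inversion (x y : row) : bool :=
  ((x.1.1 == y.1.1) && (x.1.2 < y.1.2)) ||
  ((x.1.1 == y.1.1.+1) && (x.1.2 > y.1.2)).

Section Rows.

Variables (N : nat) (D : decorated_path N).

Lemma size_rows : size (rows D) = N.
Proof. by rewrite size_map size_enum_ord. Qed.

Lemma nth_rows (i : 'I_N) x0 :
  nth x0 (rows D) i = (area_word D i, tnth (labels D) i, i \in DRise D).
Proof. by rewrite (nth_map i) ?size_enum_ord // nth_ord_enum. Qed.

Lemma labels_rows : [seq x.1.2 | x <- rows D] = labels D.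
Proof. by rewrite -map_comp map_tnth_enum. Qed.

Lemma count_label_rows t :
  count_mem t (labels D) = count (fun x => x.1.2 == t) (rows D).
Proof. by rewrite -labels_rows count_map. Qed.

Lemma count_decorated_rows : count (fun x => x.2) (rows D) = #|DRise D|.
Proof. by rewrite count_map enumT cardE /enum_mem size_filter. Qed.

Lemma area_rows : area D = \sum_(x <- rows D | ~~ x.2) x.1.1.
Proof. by rewrite big_map big_enum_cond. Qed.

Lemma dinv_rows : dinv D = pair_count row_inversion (rows D).
Proof.
rewrite -(card_pairsE (0, 0, false) _ size_rows) /dinv.
by apply: eq_card => -[i j]; rewrite !inE /= !nth_rows.
Qed.

Lemma valid_rows_rows : valid_rows (rows D).
Proof.
have nthR := nth_rows; have szR := size_rows.
case: D nthR szR => -[P l /= lP] DR /= DRP nthR szR.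
have [l_gt0 l_rise] := is_labellingP P l lP.
have riseP (i : 'I_N) : i \in DR -> is_rise P i.
  by move/(subsetP DRP); rewrite inE.
rewrite /valid_rows; apply/and4P; split.
- apply/(all_nthP (0, 0, false)) => i; rewrite szR => lti.
  rewrite (nthR (Ordinal lti)) /=; move/allP: l_gt0; apply.
  exact: mem_tnth.
- rewrite -nth0; case: (posnP N) => [N0|N_gt0].
    by rewrite nth_default ?szR ?N0.
  by rewrite (nthR (Ordinal N_gt0)) /= -leqn0 area_word_le.
- rewrite -nth0; case: (posnP N) => [N0|N_gt0].
    by rewrite nth_default ?szR ?N0.
  by rewrite (nthR (Ordinal N_gt0)) /=; apply/negP => /riseP; rewrite is_riseE.
- apply/(sortedP (0, 0, false)) => i; rewrite szR => lti.
  rewrite (nthR (Ordinal lti)) (nthR (Ordinal (ltnW lti))) /row_step /=.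
  rewrite area_word_step //=; apply/andP; split; apply/implyP.
    by move=> /eqP/(l_rise _ lti); rewrite !(tnth_nth 0).
  by move/riseP; rewrite is_riseE.
Qed.

End Rows.

Lemma rows_inj N : injective (@rows N).
Proof.
move=> D D' eqR.
have eqi (i : 'I_N) : (area_word D i, tnth (labels D) i, i \in DRise D) =
    (area_word D' i, tnth (labels D') i, i \in DRise D').
  by rewrite -!(nth_rows _ i (0, 0, false)) eqR.
have eqL : labels D = labels D'.
  by apply: eq_from_tnth => i; case: (eqi i).
have eqDR : DRise D = DRise D' by apply/setP => i; case: (eqi i).
have eqP : D = D' :> dyck_path N.
  by apply: area_word_inj => i lti; case: (eqi (Ordinal lti)).
case: D D' eqP eqL eqDR {eqR eqi} => [[P l lP] DR DRP] [[P' l' lP'] DR' DRP'] /=.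
move=> eqP eql eqDR; subst P' l' DR'.
rewrite (bool_irrelevance lP' lP) in DRP' *.
by rewrite (bool_irrelevance DRP' DRP).
Qed.

(** With [rows_inj] and [valid_rows_rows], this identifies decorated paths with valid words of rows.
    The sigma type keeps the path available as data for the bijection. *)
Lemma decorated_path_of_rows N w :
  size w = N -> valid_rows w -> {D : decorated_path N | rows D = w}.
Proof.
pose x0 : row := (0, 0, false); case: N /.
case/and4P=> l_gt0 /eqP a0 d0 /(sortedP x0) stepP.
have [|i lti|P aP] := @dyck_path_of_area_word (size w) (fun i => (nth x0 w i).1.1).
- by rewrite nth0.
- by case/and3P: (stepP i lti).
pose l := map_tuple (fun x : row => x.1.2) (in_tuple w).
have tnth_l (i : 'I_(size w)) : tnth l i = (nth x0 w i).1.2.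
  by rewrite (tnth_nth 0) /= (nth_map x0).
have lP : is_labelling P l.
  apply/is_labellingP; split; first by rewrite all_map.
  move=> i lti; rewrite !aP ?(ltnW lti) // => eqa.
  rewrite !(nth_map x0) ?(ltnW lti) //.
  by case/and3P: (stepP i lti) => _ /implyP H _; apply/H/eqP.
pose DR := [set i : 'I_(size w) | (nth x0 w i).2].
have DRP : DR \subset [set i | is_rise P i].
  apply/subsetP=> -[[|i] lti]; rewrite !inE is_riseE /=.
    by rewrite nth0 => di; rewrite di in d0.
  by rewrite !aP ?(ltnW lti) // => di; case/and3P: (stepP i lti) => _ _ /implyP->.
exists (@DecoratedPath _ (LabelledDyckPath lP) DR DRP).
apply: (@eq_from_nth _ x0); rewrite size_rows // => i lti.
rewrite (nth_rows _ (Ordinal lti)) /= aP // tnth_l inE /=.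
by case: (nth x0 w i) => [[]].
Qed.

(** * Contraction of the decorated rises *)

(* A typed row (a, t) has area a; the types 1 and 2 stand for the undecorated
   labels 1 and 2, and the type 0 for a label 1 below a decorated label 2. *)
Definition type_lt (t t' : nat) : bool := (t < t') || ((t == 0) && (t' == 0)).

(** A type 0 row of area [a] ends with a label 2 at area [a.+1], so any type may follow at area
    [a.+1] and none at [a.+2]. Hence [type_lt] puts 0 below every type, itself included. *)
Definition typed_step (x y : nat * nat) : bool :=
  (y.1 <= x.1.+1) && ((y.1 == x.1.+1) ==> type_lt x.2 y.2).

Definition typed_inversion (x y : nat * nat) : bool :=
  ((x.1 == y.1) && type_lt x.2 y.2) || ((x.1 == y.1.+1) && type_lt y.2 x.2).

Definition small_types (u : seq (nat * nat)) : bool := all (fun x => x.2 < 3) u.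

Definition valid_types (u : seq (nat * nat)) : bool :=
  [&& small_types u, (head (0, 0) u).1 == 0 & sorted typed_step u].

Definition count_type (t : nat) (u : seq (nat * nat)) : nat :=
  count (fun x => x.2 == t) u.

Definition expand_row (x : nat * nat) : seq row :=
  if x.2 == 0 then [:: (x.1, 1, false); (x.1.+1, 2, true)]
  else [:: (x.1, x.2, false)].

Definition expand (u : seq (nat * nat)) : seq row := flatten (map expand_row u).

Fixpoint contract (w : seq row) : seq (nat * nat) :=
  if w is x :: w' then
    if w' is y :: w'' then
      if y.2 then (x.1.1, 0) :: contract w'' else x.1 :: contract w'
    else [:: x.1]
  else [::].

Lemma type_cases (x : nat * nat) : x.2 < 3 ->
  [\/ x = (x.1, 0), x = (x.1, 1) | x = (x.1, 2)].
Proof. by case: x => a [|[|[|]]] //; constructor. Qed.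

Lemma size_types u : small_types u ->
  size u = count_type 0 u + count_type 1 u + count_type 2 u.
Proof.
elim: u => //= x u IH /andP[/type_cases x3 /IH->]; rewrite /count_type /=.
by case: x3 => ->; rewrite /= ?add0n ?addn0 ?addSn ?addnS //; lia.
Qed.

Lemma expandK u : contract (expand u) = u.
Proof.
(* As no expansion starts with a decorated row, [contract] never merges rows across two
   expansions. *)
have head_expand v : ~~ (head (0, 0, false) (expand v)).2.
  by case: v => [|[a [|t]]].
elim: u => //= -[a [|t]] u IH /=; rewrite /expand /= -/(expand u) ?IH //=.
case: (expand u) (head_expand u) IH => [|y w] /=; first by move=> _ <-.
by move/negPf->; move=> <-.
Qed.

(** A decorated row is a rise, so its label exceeds the one below; with labels 1 and 2 it must be a
    2 above a 1, which is what [expand_row] restores. *)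
Lemma contractK w :
    ~~ (head (0, 0, false) w).2 -> sorted row_step w ->
    all (fun x => x.1.2 \in [:: 1; 2]) w ->
  expand (contract w) = w /\ small_types (contract w).
Proof.
(* Strong induction on the length, since a contraction consumes two rows. *)
have [sz] := ubnP (size w); elim: sz w => // sz IH [|[[a l] d] [|[[b l'] d'] w]] //.
  by rewrite /= !inE => _ /negPf-> _ /andP[/orP[]/eqP-> _].
rewrite 2![size _]/= => ltsz /= /negPf-> /andP[] /and3P[/= le_ba lt_l d'_eq] w_step.
case/and3P=> l12 l'12 w12; case: d' d'_eq w_step => /= [/eqP eqb|_] w_step.
  have [l1 l'2] : l = 1 /\ l' = 2.
    by move: lt_l l12 l'12; rewrite eqb eqxx !inE /=; lia.
  (* A decorated row right after a label 2 would need a label above 2. *)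
  have head_w : ~~ (head (0, 0, false) w).2.
    case: w w12 w_step {ltsz} => [|[[c l''] [|]] w] //= /andP[+ _] /andP[+ _].
    by rewrite l'2 /row_step !inE /=; lia.
  rewrite -[expand _]/(_ :: _ :: expand (contract w)).
  have [|-> ->] := IH w _ head_w (path_sorted w_step) w12; first by lia.
  by rewrite l1 l'2 eqb.
have [|] := IH ((b, l', false) :: w) ltsz isT w_step; first by rewrite /= l'12.
rewrite /expand /= => -> ->; rewrite /expand_row /=.
by move: l12; rewrite !inE => /orP[]/eqP->.
Qed.

Definition last_row (x : nat * nat) : row := last (0, 0, false) (expand_row x).

(** Only the last row of an expansion meets the first row of the next one; the step inside an
    expansion is always valid. *)
Lemma path_expand x u : small_types (x :: u) ->
  path row_step (last_row x) (expand u) = path typed_step x u.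
Proof.
elim: u x => //= y u IH x /and3P[x3 y3 u3].
rewrite -(IH y) /= ?y3 //.
have stepE : row_step (last_row x) (head (0, 0, false) (expand_row y)) =
    typed_step x y.
  by case: (type_cases x3) => ->; case: (type_cases y3) => ->;
    rewrite /row_step /typed_step /type_lt /=; lia.
rewrite -stepE /expand /= -/(expand u).
case: (type_cases y3) => -> /=; congr (_ && _).
by rewrite /row_step /= eqxx leqnn.
Qed.

Lemma all_expand (p : pred row) u :
  all p (expand u) = all (fun x => all p (expand_row x)) u.
Proof. by elim: u => //= x u IH; rewrite /expand /= all_cat -IH. Qed.

Lemma valid_expand u : small_types u -> valid_rows (expand u) = valid_types u.
Proof.
move=> u3; rewrite /valid_rows /valid_types u3 /=.
have -> : all (fun x : row => 0 < x.1.2) (expand u).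
  rewrite all_expand; apply/allP => x /(allP u3).
  by case/type_cases=> ->.
case: u u3 => [|x u] //= u3.
rewrite -path_expand // /expand /= -/(expand u).
by case/andP: u3 => /type_cases[]-> _; rewrite /= /row_step /= ?eqxx ?leqnn.
Qed.

Lemma small_labels_expand u : small_types u ->
  all (fun x => x.1.2 \in [:: 1; 2]) (expand u).
Proof.
move=> u3; rewrite all_expand; apply/allP => x /(allP u3).
by case/type_cases=> ->.
Qed.

Lemma count_decorated_expand u : count (fun x => x.2) (expand u) = count_type 0 u.
Proof.
rewrite count_flatten -map_comp /count_type -sumn_count; congr sumn.
by apply: eq_map => -[a [|t]].
Qed.

Lemma count_label_expand u t : 0 < t < 3 -> small_types u ->
  count (fun x => x.1.2 == t) (expand u) = count_type 0 u + count_type t u.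
Proof.
move=> t12; elim: u => //= x u IH /andP[/type_cases x3 u3].
rewrite /expand /= count_cat -/(expand u) IH // /count_type /=.
by case: x3 => -> /=; lia.
Qed.

Lemma area_expand u :
  \sum_(x <- expand u | ~~ x.2) x.1.1 = \sum_(x <- u) x.1.
Proof.
rewrite big_flatten big_map; apply: eq_bigr => -[a [|t]] _ /=.
  by rewrite !big_cons big_nil /= addn0.
by rewrite big_cons big_nil addn0.
Qed.

(** Two typed rows contribute at most one inversion. For two rows of type 0 with areas a and b, the
    upper 2 of the first inverts with the lower 1 of the second when a = b, and the lower 1 of the
    first with the upper 2 of the second when a = b + 1. This is why [type_lt 0 0] holds. *)
Lemma count_inversions_expand x u : x.2 < 3 -> small_types u ->
  \sum_(x' <- expand_row x) count (row_inversion x') (expand u) =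
    count (typed_inversion x) u.
Proof.
move=> x3; elim: u => [|y u IH] /= => [_|/andP[y3 /IH <-]].
  by rewrite big1.
rewrite /expand /= -/(expand u) (eq_bigr _ (fun _ _ => count_cat _ _ _)).
rewrite big_split /=; congr (_ + _).
by case: (type_cases x3) => ->; case: (type_cases y3) => ->;
  rewrite /= !big_cons big_nil /row_inversion /typed_inversion /type_lt /=; lia.
Qed.

Lemma inversions_expand u : small_types u ->
  pair_count row_inversion (expand u) = pair_count typed_inversion u.
Proof.
elim: u => //= x u IH /andP[x3 u3].
rewrite /expand /= -/(expand u) pair_count_cat count_inversions_expand // IH //.
(* The two rows of an expansion have areas a and a + 1 in this order, which never form an
   inversion. *)
suff -> : pair_count row_inversion (expand_row x) = 0 by rewrite addnC.
by case: (type_cases x3) => -> //=; rewrite /row_inversion /=; lia.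
Qed.

(** * Standardisation along the reading order *)

Lemma pairwise_filterE (T : Type) (r : rel T) (p : pred T) s :
  pairwise r (filter p s) = pairwise (fun x y => p x && p y ==> r x y) s.
Proof.
elim: s => //= x s IH; case px: (p x) => /=; rewrite -IH; last by rewrite all_predT.
by rewrite all_filter.
Qed.

Section ReadingOrder.

Variable N : nat.
Implicit Types (a : 'I_N -> nat) (i j : 'I_N).

(** The dinv reading word with row indices in place of labels, so that it depends on the areas
    only. *)
Definition reading_order a : seq 'I_N :=
  flatten [seq [seq i <- enum 'I_N | a i == d] | d <- iota 0 N].

Definition reads_before a i j : bool :=
  (a i < a j) || ((a i == a j) && (i < j)).

Lemma eq_reading_order a a' : a =1 a' -> reading_order a = reading_order a'.
Proof.
move=> eqa; congr flatten; apply: eq_map => d.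
by apply: eq_filter => i; rewrite eqa.
Qed.

Lemma pairwise_reading_order a : pairwise (reads_before a) (reading_order a).
Proof.
(* The induction on the list of diagonals uses only its strict increase, so [iota 0 N] is
   generalised to such a list. *)
rewrite /reading_order; move: 0 => d.
move: (iota d N) (iota_ltn_sorted d N) => s.
rewrite (sorted_pairwise ltn_trans).
elim: s => //= {}d s IH /andP[/allP lt_d /IH {}IH].
rewrite pairwise_cat IH andbT; apply/andP; split.
  apply/allrelP => i j; rewrite mem_filter => /andP[/eqP ai _].
  case/flatten_mapP=> d' /lt_d /= ltd; rewrite mem_filter => /andP[/eqP aj _].
  by rewrite /reads_before ai aj ltd.
rewrite pairwise_filterE.
apply: (@sub_pairwise _ (relpre val ltn)) => [i j /= ltij|].
  apply/implyP=> /andP[/eqP ai /eqP aj].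
  by rewrite /reads_before ai aj eqxx ltij orbT.
by rewrite -pairwise_map val_enum_ord -sorted_pairwise ?iota_ltn_sorted //;
  exact: ltn_trans.
Qed.

Section Bounded.

Variable a : 'I_N -> nat.
Hypothesis ltaN : forall i, a i < N.

Lemma mem_reading_order i : i \in reading_order a.
Proof.
apply/flatten_mapP; exists (a i); first by rewrite mem_iota /= add0n.
by rewrite mem_filter eqxx mem_enum.
Qed.

Lemma uniq_reading_order : uniq (reading_order a).
Proof.
apply: (pairwise_uniq _ (pairwise_reading_order a)) => i.
by rewrite /reads_before !ltnn andbF.
Qed.

Lemma perm_reading_order : perm_eq (reading_order a) (enum 'I_N).
Proof.
apply: uniq_perm; rewrite ?uniq_reading_order ?enum_uniq // => i.
by rewrite mem_reading_order mem_enum.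
Qed.

(** Every row occurs in the reading order and [reads_before] is asymmetric, so the row read first
    has the smaller position. *)
Lemma reads_before_pairwise (Q : rel 'I_N) i j :
  pairwise Q (reading_order a) -> reads_before a i j -> Q i j.
Proof.
have idx k : index k (reading_order a) < size (reading_order a).
  by rewrite index_mem mem_reading_order.
move=> /(pairwiseP i) Qo ltij.
have {Qo} := Qo (index i (reading_order a)) (index j (reading_order a)).
rewrite !inE !nth_index ?mem_reading_order // => /(_ (idx i) (idx j)); apply.
have := @pairwiseP _ _ i _ (pairwise_reading_order a).
move=> /(_ (index j (reading_order a)) (index i (reading_order a))).
rewrite !inE !nth_index ?mem_reading_order // => /(_ (idx j) (idx i)) ltji.
rewrite ltnNge leq_eqVlt; apply/negP => /predU1P[eqij|/ltji]; last first.
  by move: ltij; rewrite /reads_before; lia.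
have eqij' : j = i.
  by rewrite -(nth_index i (mem_reading_order j)) eqij nth_index ?mem_reading_order.
by move: ltij; rewrite eqij' /reads_before !ltnn andbF.
Qed.

End Bounded.

End ReadingOrder.

Lemma dinv_reading_wordE N (D : decorated_path N) : dinv_reading_word D =
  [seq tnth (labels D) i | i <- reading_order (area_word D)].
Proof. by rewrite map_flatten -map_comp. Qed.

(** * Words determined by their types and their subwords of each type *)

Section Types.

Variables (T : eqType) (ty : T -> nat).

(** The type of the next letter tells which subword it comes from, so both words are read off in
    parallel. *)
Lemma eq_from_types (r r' : seq T) : map ty r = map ty r' ->
    (forall t, [seq x <- r | ty x == t] = [seq x <- r' | ty x == t]) ->
  r = r'.
Proof.
elim: r r' => [|x r IH] [|y r'] //= [eqt eqm] eqf.
have := eqf (ty x); rewrite /= -eqt eqxx => -[<- _].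
congr (_ :: _); apply: IH => // t.
by have := eqf t; rewrite -eqt; case: ifP => // _ [].
Qed.

Lemma pairwise_types (Q : rel T) (r : seq T) :
    (forall x y, ty x != ty y -> Q x y) ->
    (forall t, pairwise Q [seq x <- r | ty x == t]) ->
  pairwise Q r.
Proof.
move=> Qneq; elim: r => //= x r IH Qr; apply/andP; split.
  apply/allP => y r_y; case: (eqVneq (ty x) (ty y)) => [eqt|/Qneq//].
  have := Qr (ty x); rewrite eqxx /= => /andP[/allP + _]; apply.
  by rewrite mem_filter eqt eqxx.
by apply: IH => t; have := Qr t; case: ifP => //= _ /andP[].
Qed.

(** The words [S t] act as queues, and the pattern [u] tells which queue supplies the next
    letter. *)
Fixpoint shuffle_by (x0 : T) (S : nat -> seq T) (u : seq nat) : seq T :=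
  if u is t :: u' then
    head x0 (S t) ::
      shuffle_by x0 (fun t' => if t' == t then behead (S t') else S t') u'
  else [::].

Lemma shuffle_byP x0 S u :
    (forall t, size (S t) = count_mem t u) ->
    (forall t x, x \in S t -> ty x = t) ->
  map ty (shuffle_by x0 S u) = u /\
  forall t, [seq x <- shuffle_by x0 S u | ty x == t] = S t.
Proof.
elim: u S => [|t u IH] S szS tyS /=.
  by split=> // t; move/eqP: (szS t); rewrite size_eq0 => /eqP->.
case eqS: (S t) => [|y s] /=; first by have := szS t; rewrite eqS /= eqxx.
have tyy : ty y = t by apply: tyS; rewrite eqS mem_head.
have [||-> eqf] := IH (fun t' => if t' == t then behead (S t') else S t').
- move=> t'; case: eqP => [->|/eqP/negPf neq].
    by rewrite size_behead szS /= eqxx.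
  by rewrite szS /= eq_sym neq.
- by move=> t' x; case: eqP => _ => [/mem_behead|]; apply: tyS.
split=> [|t']; first by rewrite tyy.
rewrite tyy eqf (eq_sym t); case: eqP => // ->.
by rewrite eqS.
Qed.

End Types.

(* Labels of type 0, 1, 2 are those in 1..k, k+1..n and n+1..m+n-k. *)
Definition label_type (k n x : nat) : nat := (k < x) + (n < x).

Definition shuffle_block (k n m t : nat) : seq nat :=
  nth [::] [:: iota 1 k; rev (iota k.+1 (n - k)); rev (iota n.+1 (m - k))] t.

Section Shuffle.

Variables k n m : nat.
Hypotheses (hkn : k <= n) (hkm : k <= m).

Local Notation ty := (label_type k n).
Local Notation block := (shuffle_block k n m).

Lemma mem_block t x :
  x \in block t = [&& ty x == t & 0 < x <= m + n - k].
Proof.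
by case: t => [|[|[|t]]]; rewrite /shuffle_block /label_type /= ?nth_nil ?mem_rev
  ?mem_iota ?in_nil; lia.
Qed.

Lemma uniq_block t : uniq (block t).
Proof.
by case: t => [|[|[|t]]];
  rewrite /shuffle_block /= ?nth_nil ?rev_uniq ?iota_uniq.
Qed.

Lemma pairwise_block t :
  pairwise (fun x y => if t == 0 then x < y else y < x) (block t).
Proof.
have up i d : pairwise ltn (iota i d).
  by rewrite -(sorted_pairwise ltn_trans) iota_ltn_sorted.
have down i d : pairwise (fun x y => y < x) (rev (iota i d)).
  by rewrite -(sorted_pairwise (rev_trans ltn_trans)) rev_sorted iota_ltn_sorted.
by case: t => [|[|[|t]]]; rewrite /shuffle_block //= nth_nil.
Qed.

(** The labels are distinct, so a block that is a subsequence of [r] is the whole subword on its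
    entries. Types above 2 have an empty block. *)
Lemma filter_types_block r :
    perm_eq r (iota 1 (m + n - k)) ->
    (forall t, t < 3 -> subseq (block t) r) ->
  forall t, [seq x <- r | ty x == t] = block t.
Proof.
move=> perm_r sub_r t.
have uniq_r : uniq r by rewrite (perm_uniq perm_r) iota_uniq.
have r_mem x : x \in r = (0 < x <= m + n - k).
  by rewrite (perm_mem perm_r) mem_iota; lia.
have -> : [seq x <- r | ty x == t] = [seq x <- r | x \in block t].
  by apply: eq_in_filter => x; rewrite r_mem mem_block => ->; rewrite andbT.
apply/esym; case: (ltnP t 3) => [lt3|]; first exact/subseq_uniqP/sub_r.
by case: t => [|[|[|t]]] // _; rewrite /shuffle_block /= nth_nil filter_pred0.
Qed.

(** The blocks partition the values by type, and each block is free of repetitions. *)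
Lemma perm_of_blocks r : (forall t, [seq x <- r | ty x == t] = block t) ->
  perm_eq r (iota 1 (m + n - k)).
Proof.
move=> eqf.
have r_mem x : x \in r = (0 < x <= m + n - k).
  by have := mem_block (ty x) x; rewrite -eqf mem_filter eqxx.
apply: uniq_perm; rewrite ?iota_uniq //; last first.
  by move=> x; rewrite r_mem mem_iota; lia.
apply: count_mem_uniq => x.
have -> : count_mem x r = count_mem x (block (ty x)).
  rewrite -eqf count_filter; apply: eq_count => y /=.
  by case: eqP => // ->; rewrite eqxx.
by rewrite count_uniq_mem ?uniq_block // mem_block eqxx r_mem.
Qed.

(* Standardisation: within a type, the reading order decides the comparison of
   labels, increasingly for type 0 and decreasingly for types 1 and 2. *)
Lemma label_ltE N (a l : 'I_N -> nat) i j :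
    (forall i, a i < N) ->
    (forall t, [seq x <- map l (reading_order a) | ty x == t] = block t) ->
    reads_before a i j ->
  (l i < l j) = type_lt (ty (l i)) (ty (l j)).
Proof.
move=> ltaN eqf ltij.
pose Q x y := (ty x == ty y) ==> (if ty x == 0 then x < y else y < x).
have : pairwise Q (map l (reading_order a)).
  apply: (pairwise_types (ty := ty)) => [x y /negPf neq|t]; first by rewrite /Q neq.
  rewrite pairwise_filterE; have := pairwise_block t; rewrite -eqf pairwise_filterE.
  apply: sub_pairwise => x y /implyP H; apply/implyP => xyt.
  by have := H xyt; rewrite /Q; case/andP: xyt => /eqP-> _ ->; rewrite implybT.
rewrite pairwise_map => /(reads_before_pairwise ltaN)/(_ ltij).
(* Labels of different types compare as their types, [label_type] being monotone; for equal types
   [Q] decides. *)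
by rewrite /Q /type_lt /label_type /=; case: ifP; lia.
Qed.

End Shuffle.

(** * The bijection *)

(** Two injective codings with the same image: encode on one side and decode on the other, the sigma
    types supplying the preimages. *)
Lemma bijection_of_codes (A B C : Type) (cA : A -> C) (cB : B -> C) :
    injective cA -> injective cB ->
    (forall a, {b | cB b = cA a}) -> (forall b, {a | cA a = cB b}) ->
  exists f : A -> B, bijective f /\ forall a, cB (f a) = cA a.
Proof.
move=> injA injB fB fA; exists (fun a => sval (fB a)).
split=> [|a]; last exact: svalP (fB a).
exists (fun b => sval (fA b)) => [a|b].
  by apply: injA; rewrite (svalP (fA _)) (svalP (fB a)).
by apply: injB; rewrite (svalP (fB _)) (svalP (fA b)).
Qed.

(** * Typed words as a common code for both families *)

Section Codes.

Variables m n k : nat.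
Hypotheses (hkn : k <= n) (hkm : k <= m).

Local Notation ty := (label_type k n).
Local Notation block := (shuffle_block k n m).

(** The common image of [PF2_code] and [shuffle_code]. Each of the [k] type 0 rows absorbs a label 1
    and a label 2, which leaves [n - k] and [m - k] rows of the other types. *)
Definition is_code (u : seq (nat * nat)) : bool :=
  [&& valid_types u, count_type 0 u == k, count_type 1 u == n - k
    & count_type 2 u == m - k].

Definition PF2_code (D : PF2 m n k) : seq (nat * nat) := contract (rows (sval D)).

Lemma expand_PF2_code D :
  expand (PF2_code D) = rows (sval D) /\ is_code (PF2_code D).
Proof.
rewrite /PF2_code; case: D => D /= /and4P[/eqP dec l12 /eqP one /eqP two].
have vD := valid_rows_rows D.
have /and4P[_ _ d0 wD] := vD.
have := contractK d0 wD; rewrite -all_map labels_rows => /(_ l12).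
set u := contract _ => -[eqD small].
move: dec one two vD; rewrite -count_decorated_rows !count_label_rows.
rewrite -eqD valid_expand // => dec one two valid; split=> //.
rewrite /is_code valid /=; move: one two dec.
by rewrite !count_label_expand // count_decorated_expand; lia.
Qed.

Lemma PF2_of_code u : is_code u -> {D : PF2 m n k | PF2_code D = u}.
Proof.
case/and4P=> valid /eqP c0 /eqP c1 /eqP c2.
have /and3P[small _ _] := valid.
have one := @count_label_expand u 1 isT small.
have two := @count_label_expand u 2 isT small.
have l12 := small_labels_expand small.
have sz : size (expand u) = m + n.
  rewrite -(count_predC (fun x => x.1.2 == 1)) one.
  rewrite (@eq_in_count _ _ (fun x => x.1.2 == 2)) ?two; first by lia.
  by move=> x /(allP l12); rewrite !inE /=; lia.
have [|D eqD] := decorated_path_of_rows sz; first by rewrite valid_expand.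
have PD : @is_PF2 m n k D.
  rewrite /is_PF2 !count_label_rows -count_decorated_rows -labels_rows all_map eqD.
  rewrite count_decorated_expand c0 eqxx l12 /=.
  by rewrite one two; lia.
by exists (exist _ D PD); rewrite /PF2_code /= eqD expandK.
Qed.

Lemma PF2_code_inj : injective PF2_code.
Proof.
move=> D D' eqc; apply: val_inj; apply: rows_inj => /=.
by rewrite -(expand_PF2_code D).1 eqc (expand_PF2_code D').1.
Qed.

Lemma PF2_code_stats (D : PF2 m n k) :
  dinv (sval D) = pair_count typed_inversion (PF2_code D) /\
  area (sval D) = \sum_(x <- PF2_code D) x.1.
Proof.
have [eqD /and4P[/and3P[small _ _] _ _ _]] := expand_PF2_code D.
by rewrite dinv_rows area_rows -eqD inversions_expand // area_expand.
Qed.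

(** Only the type of a label is kept: the labels of one type appear in a prescribed order in the
    reading word, so they can be recovered. *)
Definition shuffle_code (D : shuffle_path k n m) : seq (nat * nat) :=
  [seq (x.1.1, ty x.1.2) | x <- rows (sval D)].

Section ShufflePath.

Variable D : shuffle_path k n m.

Let N := m + n - k.
Let a (i : 'I_N) := area_word (sval D) i.
Let l (i : 'I_N) := tnth (labels (sval D)) i.

Lemma DRise_shuffle_path : DRise (sval D) = set0.
Proof. by case: D => ? /= /and5P[/eqP]. Qed.

Lemma area_lt i : a i < N.
Proof. exact: leq_ltn_trans (area_word_le _ (ltn_ord i)) (ltn_ord i). Qed.

Lemma perm_reading_labels :
  perm_eq [seq l i | i <- reading_order a] (labels (sval D)).
Proof. rewrite -map_tnth_enum; exact/perm_map/perm_reading_order/area_lt. Qed.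

Lemma filter_reading_labels t :
  [seq x <- map l (reading_order a) | ty x == t] = block t.
Proof.
have /and5P[_ permD sub0 sub1 sub2] := svalP D.
apply: filter_types_block => //.
  by rewrite (perm_trans perm_reading_labels).
by rewrite -dinv_reading_wordE; case=> [|[|[|]]].
Qed.

Lemma shuffle_label_lt i j :
  reads_before a i j -> (l i < l j) = type_lt (ty (l i)) (ty (l j)).
Proof. exact: (label_ltE hkn hkm area_lt filter_reading_labels). Qed.

Lemma size_shuffle_code : size (shuffle_code D) = N.
Proof. by rewrite size_map size_rows. Qed.

Lemma nth_shuffle_code (i : 'I_N) x0 : nth x0 (shuffle_code D) i = (a i, ty (l i)).
Proof. by rewrite (nth_map (0, 0, false)) ?size_rows // nth_rows. Qed.

Lemma is_code_shuffle_code : is_code (shuffle_code D).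
Proof.
have countE t : count_type t (shuffle_code D) = size (block t).
  rewrite -filter_reading_labels size_filter (permP perm_reading_labels).
  by rewrite -labels_rows /count_type !count_map.
rewrite /is_code !countE /shuffle_block /= !size_rev !size_iota !eqxx !andbT.
have /and4P[_ a0 _ stepD] := valid_rows_rows (sval D).
apply/and3P; split.
- by rewrite /small_types all_map; apply/allP=> x _; rewrite /= /label_type; lia.
- by move: a0; rewrite /shuffle_code; case: (rows _).
apply/(sortedP (0, 0)) => i; rewrite size_shuffle_code => lti.
move/(sortedP (0, 0, false))/(_ i): stepD; rewrite size_rows => /(_ lti).
rewrite (nth_shuffle_code (Ordinal lti)) (nth_shuffle_code (Ordinal (ltnW lti))).
rewrite (nth_rows _ (Ordinal lti)) (nth_rows _ (Ordinal (ltnW lti))).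
case/and3P=> /= le_a /implyP lt_l _; rewrite /typed_step /= le_a /=.
(* The lower row lies on the lower diagonal, hence is read first, so labels compare as types. *)
apply/implyP=> aS; rewrite -shuffle_label_lt; first exact: lt_l.
by rewrite /reads_before (eqP aS) ltnSn.
Qed.

Lemma shuffle_code_stats :
  dinv (sval D) = pair_count typed_inversion (shuffle_code D) /\
  area (sval D) = \sum_(x <- shuffle_code D) x.1.
Proof.
split; last first.
  rewrite area_rows !big_map /=.
  by apply: eq_bigl => i; rewrite DRise_shuffle_path inE.
rewrite -(card_pairsE (0, 0) _ size_shuffle_code) /dinv.
apply: eq_card => -[i j]; rewrite !inE /= !nth_shuffle_code.
rewrite /diagonal_inversion /typed_inversion /= -!/(a _) -!/(l _).
(* On a common diagonal row [i] is read first; when the area of [i] is one more than that of [j],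
   row [j] is. Both tests ask whether the label read first is the smaller one. *)
case: ltnP => //= ltij; congr (_ || _).
  case: eqP => //= eqa; rewrite shuffle_label_lt //.
  by rewrite /reads_before eqa eqxx ltij orbT.
case: eqP => //= eqa; rewrite shuffle_label_lt //.
by rewrite /reads_before eqa ltnSn.
Qed.

End ShufflePath.

Lemma shuffle_code_inj : injective shuffle_code.
Proof.
move=> D D' eqc; apply: val_inj; apply: rows_inj => /=.
have eqi (i : 'I_(m + n - k)) := congr1 (fun u => nth (0, 0) u i) eqc.
have eqa : (fun i : 'I__ => area_word (sval D) i) =1
    (fun i : 'I_(m + n - k) => area_word (sval D') i).
  by move=> i; have := eqi i; rewrite !nth_shuffle_code => -[].
have eqt i : ty (tnth (labels (sval D)) i) = ty (tnth (labels (sval D')) i).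
  by have := eqi i; rewrite !nth_shuffle_code => -[].
(* Equal areas give the same reading order; the two label words along it then agree in types and in
   blocks. *)
have eqr : map (tnth (labels (sval D))) (reading_order (area_word (sval D))) =
    map (tnth (labels (sval D'))) (reading_order (area_word (sval D))).
  apply: (eq_from_types (ty := ty)) => [|t].
    by rewrite -!map_comp; apply: eq_map => i /=.
  by rewrite filter_reading_labels (eq_reading_order eqa) filter_reading_labels.
apply: eq_map => i; rewrite !DRise_shuffle_path !inE eqa.
move/eq_in_map: eqr => -> //.
by apply: mem_reading_order => j; apply: area_lt.
Qed.

(** Standardisation: the areas fix the reading order, and shuffling the blocks along the types met
    in that order produces the reading word. *)
Lemma shuffle_path_of_code u :
  is_code u -> {D : shuffle_path k n m | shuffle_code D = u}.
Proof.
case/and4P=> /and3P[small /eqP a0 /(sortedP (0, 0)) stepu] /eqP c0 /eqP c1 /eqP c2.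
pose N := m + n - k.
have szu : size u = N by rewrite size_types // c0 c1 c2 /N; lia.
pose a (i : 'I_N) := (nth (0, 0) u i).1; pose t (i : 'I_N) := (nth (0, 0) u i).2.
have ltaN i : a i < N.
  case: i => i; rewrite /a /=; suff le_a : i < N -> (nth (0, 0) u i).1 <= i.
    by move=> lti; apply: leq_ltn_trans (le_a lti) lti.
  elim: i => [|i IH] lti; first by rewrite nth0 a0.
  have := stepu i; rewrite szu => /(_ lti)/andP[H _].
  by apply: leq_trans H _; rewrite ltnS IH // ltnW.
pose o := reading_order a.
have o_enum : perm_eq o (enum 'I_N) by apply: perm_reading_order.
have [||r_ty r_block] := @shuffle_byP _ ty 0 block (map t o).
- move=> s; rewrite count_map (permP o_enum).
  have -> : count (preim t (pred1 s)) (enum 'I_N) = count_type s u.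
    rewrite -[u in RHS](mkseq_nth (0, 0)) /mkseq szu -val_enum_ord -map_comp.
    by rewrite /count_type [RHS]count_map.
  case: s => [|[|[|s]]]; rewrite ?c0 ?c1 ?c2 /shuffle_block /=
    ?size_rev ?size_iota // nth_nil.
  (* No row has a type above 2, matching the empty block. *)
  apply/esym/eqP; rewrite -leqn0 leqNgt -has_count; apply/hasPn => x /(allP small).
  by rewrite /=; lia.
- by move=> s x; rewrite mem_block // => /andP[/eqP].
set r := shuffle_by _ _ _ in r_ty r_block.
(* Each row receives the entry of the reading word at its own reading position. *)
pose l (i : 'I_N) := nth 0 r (index i o).
have szr : size r = size o by rewrite -(size_map ty) r_ty size_map.
have idx i : index i o < size o by rewrite index_mem mem_reading_order.
have lr : map l o = r.
  apply: (@eq_from_nth _ 0) => [|j]; rewrite size_map // => ltj.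
  have lto : j < N by have := perm_size o_enum; rewrite size_enum_ord => <-.
  pose i0 := Ordinal lto; rewrite (nth_map i0) // /l index_uniq //.
  exact: uniq_reading_order.
have ty_l i : ty (l i) = t i.
  rewrite /l -(nth_map 0 0 ty) ?szr // r_ty (nth_map i) // nth_index //.
  exact: mem_reading_order.
have l_lt i j : reads_before a i j -> (l i < l j) = type_lt (t i) (t j).
  rewrite -!ty_l; apply: (label_ltE hkn hkm ltaN) => s.
  by rewrite -/o lr r_block.
have perm_l : perm_eq (map l (enum 'I_N)) (iota 1 N).
  rewrite -(permPl (perm_map l o_enum)) lr.
  exact: (perm_of_blocks hkn hkm r_block).
pose w := [seq (a i, l i, false) | i <- enum 'I_N].
have szw : size w = N by rewrite size_map size_enum_ord.
have nthw (i : 'I_N) : nth (0, 0, false) w i = (a i, l i, false).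
  by rewrite (nth_map i) ?size_enum_ord // nth_ord_enum.
have [|D eqD] := decorated_path_of_rows szw.
  apply/and4P; split.
  - rewrite all_map; apply/allP => i _ /=.
    have : l i \in iota 1 N by rewrite -(perm_mem perm_l) map_f ?mem_enum.
    by rewrite mem_iota => /andP[].
  - rewrite -nth0; case: (posnP N) => [N0|N_gt0].
      by rewrite nth_default ?szw ?N0.
    by rewrite (nthw (Ordinal N_gt0)) /a /= nth0 a0.
  - by rewrite /w; case: (enum _).
  apply/(sortedP (0, 0, false)) => i; rewrite szw => lti.
  have := stepu i; rewrite szu => /(_ lti)/andP[le_a /implyP lt_t].
  rewrite (nthw (Ordinal lti)) (nthw (Ordinal (ltnW lti))).
  rewrite /row_step /= le_a /= andbT.
  apply/implyP => aS; rewrite l_lt; first exact: lt_t.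
  by rewrite /reads_before (eqP aS) ltnSn.
have areaD : (fun i : 'I_N => area_word D i) =1 a.
  by move=> i; have := nth_rows D i (0, 0, false); rewrite eqD nthw => -[].
have labelsD : tnth (labels D) =1 l.
  by move=> i; have := nth_rows D i (0, 0, false); rewrite eqD nthw => -[].
have wordD : dinv_reading_word D = r.
  by rewrite dinv_reading_wordE (eq_reading_order areaD) (eq_map labelsD) lr.
have PD : @is_shuffle_path k n m D.
  have sub_r s : subseq (block s) r by rewrite -r_block filter_subseq.
  rewrite /is_shuffle_path wordD (sub_r 0) (sub_r 1) (sub_r 2) !andbT.
  apply/andP; split; last by rewrite -map_tnth_enum (eq_map labelsD).
  rewrite -cards_eq0 -count_decorated_rows eqD count_map.
  by rewrite (eq_count (a2 := pred0)) ?count_pred0.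
exists (exist _ D PD); rewrite /shuffle_code /= eqD -map_comp.
apply: (@eq_from_nth _ (0, 0)); rewrite size_map size_enum_ord // => i lti.
rewrite (nth_map (Ordinal lti)) ?size_enum_ord //.
rewrite (nth_ord_enum _ (Ordinal lti)) /= ty_l /a /t /=.
by case: (nth _ u i).
Qed.

End Codes.

Theorem theorem6p1 (m n k : nat) (hkn : k <= n) (hkm : k <= m) :
  exists f : PF2 m n k -> shuffle_path k n m,
    bijective f /\
    forall D : PF2 m n k,
      dinv (sval (f D)) = dinv (sval D) /\ area (sval (f D)) = area (sval D).
Proof.
have [||f [f_bij f_code]] := bijection_of_codes (PF2_code_inj hkn hkm)
    (shuffle_code_inj hkn hkm).
- by move=> D; apply: shuffle_path_of_code => //; case: (expand_PF2_code hkn hkm D).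
- by move=> D; apply: PF2_of_code => //; apply: is_code_shuffle_code.
exists f; split=> // D.
(* Both statistics depend on the code alone, which [f] preserves. *)
have [-> ->] := PF2_code_stats hkn hkm D.
by have [-> ->] := shuffle_code_stats hkn hkm (f D); rewrite f_code.
Qed.
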